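(* The pair $(\ell_1,\ell_1)$ does not have the adjoint compact perturbation property (ACPP). That is, there exists a bounded linear operator $T:\ell_1\to\ell_1$ such that $T^*$ does not attain its norm and $\|T\|_e<\|T\|$.
   Context: The scalar field is $\mathbb{K}=\mathbb{R}$ or $\mathbb{C}$. For Banach spaces $X,Y$, $\mathcal{L}(X,Y)$ is the Banach space of bounded linear operators and $\mathcal{K}(X,Y)$ the subspace of compact operators; $S_X$ is the unit sphere of $X$. An operator $T\in\mathcal{L}(X,Y)$ attains its norm if there is $x\in S_X$ with $\|Tx\|=\|T\|$. The essential norm is $\|T\|_e=\inf_{K\in\mathcal{K}(X,Y)}\|T-K\|$. The pair $(X,Y)$ has the adjoint compact perturbation property (ACPP) if every $T\in\mathcal{L}(X,Y)$ whose adjoint $T^*:Y^*\to X^*$ does not attain its norm satisfies $\|T\|_e=\|T\|$. *)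

(* Defs.v *)
From HB Require Import structures.
From mathcomp Require Import all_boot all_order all_algebra.
From mathcomp Require Import all_classical all_reals all_analysis.
From mathcomp Require Import complex.

Set Implicit Arguments.
Unset Strict Implicit.
Unset Printing Implicit Defensive.

Import Order.TTheory GRing.Theory Num.Theory.
Import numFieldNormedType.Exports.

Local Open Scope classical_set_scope.
Local Open Scope ring_scope.

(* The scalar field K = R or C, over an arbitrary model R of the reals.       *)
(* Norms of normed modules over K take values in K itself; on R[i] the order  *)
(* relates only elements with equal imaginary parts, so suprema and infima of *)
(* nonempty sets of nonnegative scalars, taken in K, are the real ones.       *)
Variant scalar_field := RealScalars | ComplexScalars.

Definition scalars (R : realType) (F : scalar_field) : numFieldType :=
  match F with RealScalars => R | ComplexScalars => R[i] end.

Section scalar_theory.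
Variables (R : realType) (F : scalar_field).
Local Notation K := (scalars R F).

Lemma scalar_supremums (A : set K) :
  A !=set0 -> ubound A !=set0 -> (forall x, A x -> 0 <= x) ->
  supremums A !=set0.
Proof.
case: F A => /= A A0 [u Au] Age0.
  have sA : has_sup A by split=> //; exists u.
  exists (sup A); split; first exact: sup_upper_bound.
  by move=> v Av; apply: ge_sup.
pose B : set R := [set complex.Re x | x in A].
have reA x : A x -> x = (complex.Re x)%:C%C.
  by move=> /Age0; case: x => a b; rewrite lecE/= => /andP[/eqP -> _].
have ReA x : A x -> B (complex.Re x) by exists x.
have sB : has_sup B.
  split; first by case: A0 => x Ax; exists (complex.Re x); apply: ReA.
  exists (complex.Re u) => _ [x Ax <-].
  by have := Au _ Ax; rewrite lecE => /andP[].
exists ((sup B)%:C%C); split.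
  move=> x Ax; rewrite (reA x Ax) lecR.
  by apply: sup_upper_bound => //; exact: ReA.
move=> v Av; case: A0 => x0 Ax0.
have vi : v = (complex.Re v)%:C%C.
  have := Av _ Ax0; rewrite (reA _ Ax0) lecE/= => /andP[/eqP + _].
  by case: v {Av} => a b /= ->.
rewrite vi lecR; apply: ge_sup; first by case: sB.
by move=> _ [x Ax <-]; have := Av _ Ax; rewrite lecE => /andP[].
Qed.

Lemma scalar_supremumP (A : set K) :
  A !=set0 -> ubound A !=set0 -> (forall x, A x -> 0 <= x) ->
  supremums A (supremum 0 A).
Proof.
move=> A0 uA Age0; rewrite /supremum ifF; last exact/negbTE/set0P.
by case: xgetP => // nA; case: (scalar_supremums A0 uA Age0) => s /nA.
Qed.

Lemma scalar_infimumP (A : set K) :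
  A !=set0 -> (forall x, A x -> 0 <= x) -> infimums A (infimum 0 A).
Proof.
move=> A0 Age0; rewrite /infimum ifF; last exact/negbTE/set0P.
case: xgetP => // nA; exfalso.
have [|||s [sub slub]] := @scalar_supremums [set y | 0 <= y /\ lbound A y].
- by exists 0; split.
- by case: A0 => a Aa; exists a => y [_]; apply.
- by move=> y [].
apply: (nA s); split; first by move=> a Aa; apply: slub => y [_]; apply.
move=> v Av; have [a Aa] := A0.
have vr : v \is Num.real by rewrite (ler_real (Av _ Aa)) ger0_real ?Age0.
have s0 : 0 <= s by apply: sub; split.
have [v0|v0] := real_leP (real0 _) vr; first by apply: sub.
exact: le_trans (ltW v0) s0.
Qed.

Lemma scalar_cvg_supremum (u : K^nat) M :
  (forall n, 0 <= u n) -> {homo u : m n / (m <= n)%N >-> m <= n} ->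
  (forall n, u n <= M) -> u @ \oo --> supremum 0 (range u).
Proof.
move=> u0 uinc uM.
have [sub slub] : supremums (range u) (supremum 0 (range u)).
  apply: scalar_supremumP; first by exists (u 0%N), 0%N.
    by exists M => _ [n _ <-].
  by move=> _ [n _ <-].
set s := supremum _ _ in sub slub *.
have us n : u n <= s by apply: sub; exists n.
have sr : s \is Num.real by apply: ger0_real; apply: le_trans (us 0%N).
apply/cvgrPdist_lt => e e0.
have [n un] : exists n, s - e < u n.
  apply: contrapT => nex.
  suff : s <= s - e by rewrite lerBrDr gerDl lt_geF.
  apply: slub => _ [n _ <-]; rewrite real_leNgt//.
  - by apply/negP => un; apply: nex; exists n.
  - exact: ger0_real.
  - by rewrite rpredB// gtr0_real.
near=> m.
have un_m : u n <= u m by apply: uinc; near: m; exact: nbhs_infty_ge.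
rewrite ger0_norm ?subr_ge0 ?us// ltrBlDl -ltrBlDr.
exact: lt_le_trans un un_m.
Unshelve. all: by end_near. Qed.

Lemma scalar_complete (G : set_system K) :
  ProperFilter G -> cauchy G -> cvg G.
Proof.
case: F G => /= G FG; first exact: R_complete.
move=> /cauchy_ballP cG.
have normR (r : R) : `|r%:C%C| = `|r|%:C%C :> R[i].
  by rewrite normc_def/= expr0n/= addr0 sqrtr_sqr.
have normRe (x : R[i]) : `|complex.Re x|%:C%C <= `|x| := normc_ge_Re x.
have normIm (x : R[i]) : `|complex.Im x|%:C%C <= `|x|.
  case: x => a b; rewrite normc_def/= lecR -[leLHS]sqrtr_sqr ler_wsqrtr//.
  by rewrite lerDr sqr_ge0.
have normRI (x : R[i]) : `|x| <= (`|complex.Re x| + `|complex.Im x|)%:C%C.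
  case: x => a b /=; rewrite rmorphD/= -!normR.
  have -> : Complex a b = a%:C%C + 'i%C * b%:C%C.
    by rewrite {1}[Complex a b]complexE.
  rewrite (le_trans (ler_normD _ _))// lerD2l normrM.
  by rewrite [`|'i%C|]normc_def/= expr0n/= add0r expr1n sqrtr1 mul1r.
have proj_cauchy (p : R[i] -> R) :
    (forall x y, `|p x - p y|%:C%C <= `|x - y|) -> cvg (p @ G).
  move=> pl; apply: R_complete; apply/cauchy_ballP => e e0.
  have e0' : 0 < e%:C%C by rewrite ltcR.
  have [[A B] /= [GA GB] AB] := cG _ e0'.
  exists (p @` A, p @` B) => /=.
    by split; [apply: filterS GA|apply: filterS GB] => x Ax; exists x.
  move=> [_ _] [/= [x Ax <-] [y By <-]].
  have := AB (x, y) (conj Ax By); rewrite -!ball_normE /= => xy.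
  by rewrite -ltcR; exact: le_lt_trans (pl _ _) xy.
have /cvg_ex[a Ga] : cvg ((@complex.Re R) @ G).
  apply: proj_cauchy => -[a b] [c d].
  exact: normRe (Complex a b - Complex c d).
have /cvg_ex[b Gb] : cvg ((@complex.Im R) @ G).
  apply: proj_cauchy => -[a' b] [c d].
  exact: normIm (Complex a' b - Complex c d).
apply: (@cvgP _ _ (Complex a b : scalars R ComplexScalars)).
apply/(@cvgrPdist_lt (scalars R ComplexScalars)) => e e0.
have er : e = (complex.Re e)%:C%C.
  by move: e0; rewrite ltcE/=; case: (e) => c d /= /andP[/eqP -> _].
have e0' : 0 < complex.Re e / 2 by rewrite divr_gt0// -ltcR -er.
have ReB z : complex.Re (Complex a b - z) = a - complex.Re z by case: z.
have ImB z : complex.Im (Complex a b - z) = b - complex.Im z by case: z.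
near=> z; rewrite er (le_lt_trans (normRI _))// ltcR.
rewrite [ltRHS]splitr ReB ImB ltrD//.
  by near: z; move/cvgrPdist_lt: Ga; apply.
by near: z; move/cvgrPdist_lt: Gb; apply.
Unshelve. all: by end_near. Qed.

End scalar_theory.

Section bounded_operators.
Variables (R : realType) (F : scalar_field).
Local Notation K := (scalars R F).
Variables X Y : normedModType K.

Definition bounded_linear : {pred X -> Y} := fun f =>
  `[< linear f /\ exists M : K, forall x, `|f x| <= M * `|x| >].

Record bounded_op := BoundedOp {
  bounded_op_fun :> X -> Y;
  bounded_opP : bounded_op_fun \in bounded_linear }.

HB.instance Definition _ := [isSub for bounded_op_fun].
HB.instance Definition _ := [Choice of bounded_op by <:].

Lemma bounded_linear_submod : submod_closed bounded_linear.
Proof.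
split.
  apply/asboolP; split; first by move=> a x y; rewrite scaler0 addr0.
  by exists 0 => x; rewrite normr0 mul0r.
move=> a f g /asboolP[fl [M fM]] /asboolP[gl [N gN]].
apply/asboolP; split.
  move=> b x y; rewrite !fctE fl gl !scalerDr !scalerA.
  by rewrite addrACA mulrC.
exists (`|a| * M + N) => x; rewrite !fctE (le_trans (ler_normD _ _))//.
by rewrite mulrDl lerD// normrZ -mulrA ler_wpM2l.
Qed.

HB.instance Definition _ :=
  GRing.isSubmodClosed.Build K (X -> Y) bounded_linear bounded_linear_submod.
HB.instance Definition _ := [SubChoice_isSubLmodule of bounded_op by <:].

Lemma bounded_op_linear (f : bounded_op) : linear f.
Proof. by have /asboolP[] := bounded_opP f. Qed.

HB.instance Definition _ (f : bounded_op) :=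
  GRing.isLinear.Build K X Y *:%R (bounded_op_fun f) (bounded_op_linear f).

Definition op_norm (f : bounded_op) : K :=
  supremum 0 [set `|f x| | x in [set x : X | `|x| <= 1]].

Lemma op_norm_supremums (f : bounded_op) :
  supremums [set `|f x| | x in [set x : X | `|x| <= 1]] (op_norm f).
Proof.
apply: scalar_supremumP.
- by exists `|f 0|, 0 => //=; rewrite normr0.
- have /asboolP[_ [M fM]] := bounded_opP f; exists `|M| => _ [x /= x1 <-].
  have M0 : 0 <= M * `|x| := le_trans (normr_ge0 _) (fM x).
  rewrite (le_trans (fM x))// -(ger0_norm M0) normrM normr_id.
  by rewrite ler_piMr.
- by move=> _ [x _ <-].
Qed.

Lemma op_norm_le (f : bounded_op) M :
  (forall x, `|x| <= 1 -> `|f x| <= M) -> op_norm f <= M.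
Proof. by have [_ h] := op_norm_supremums f => fM; apply: h => _ [x /fM + <-]. Qed.

Lemma op_norm_ge (f : bounded_op) x : `|x| <= 1 -> `|f x| <= op_norm f.
Proof. by have [h _] := op_norm_supremums f => x1; apply: h; exists x. Qed.

Lemma op_norm_ge0 f : 0 <= op_norm f.
Proof. by rewrite (le_trans (normr_ge0 (f 0)))// op_norm_ge// normr0. Qed.

Lemma op_norm_bound (f : bounded_op) x : `|f x| <= op_norm f * `|x|.
Proof.
have [->|x0] := eqVneq x 0; first by rewrite linear0 !normr0 mulr0.
rewrite -ler_pdivrMr ?normr_gt0// mulrC.
rewrite -[X in X * _]ger0_norm ?invr_ge0// -normrZ -linearZ.
by apply: op_norm_ge; rewrite normrZ ger0_norm ?invr_ge0// mulVf ?normr_eq0.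
Qed.

Lemma op_normD f g : op_norm (f + g) <= op_norm f + op_norm g.
Proof.
apply: op_norm_le => x x1; rewrite (le_trans (ler_normD _ _))//.
by rewrite lerD// op_norm_ge.
Qed.

Lemma op_normZ a f : op_norm (a *: f) = `|a| * op_norm f.
Proof.
have le b g : op_norm (b *: g) <= `|b| * op_norm g.
  by apply: op_norm_le => x x1; rewrite normrZ ler_wpM2l// op_norm_ge.
apply/le_anti; rewrite le/=; have [->|a0] := eqVneq a 0.
  by rewrite normr0 mul0r op_norm_ge0.
rewrite -ler_pdivlMl ?normr_gt0// -normfV.
by rewrite -[in leLHS](scalerK a0 f).
Qed.

Lemma op_norm0_eq0 f : op_norm f = 0 -> f = 0.
Proof.
move=> f0; apply: val_inj; apply/funext => x.
by apply/eqP; rewrite -normr_le0 (le_trans (op_norm_bound f x))// f0 mul0r.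
Qed.

HB.instance Definition _ :=
  Lmodule_isNormed.Build K bounded_op op_normD op_normZ op_norm0_eq0.

End bounded_operators.

Section operators.
Variables (R : realType) (F : scalar_field).
Local Notation K := (scalars R F).

Lemma bounded_linear_comp (X Y Z : normedModType K)
    (g : bounded_op Y Z) (f : bounded_op X Y) :
  g \o f \in @bounded_linear R F X Z.
Proof.
apply/asboolP; split=> [a x y|]; first by rewrite /= !linearP.
exists (op_norm g * op_norm f) => x /=.
rewrite (le_trans (op_norm_bound g _))// -mulrA ler_wpM2l ?op_norm_ge0//.
exact: op_norm_bound.
Qed.

Definition comp_op (X Y Z : normedModType K)
    (g : bounded_op Y Z) (f : bounded_op X Y) : bounded_op X Z :=
  BoundedOp (bounded_linear_comp g f).

Definition dual (X : normedModType K) : normedModType K :=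
  bounded_op X (K^o : normedModType K).

Lemma adjoint_bounded_linear (X Y : normedModType K) (T : bounded_op X Y) :
  (fun g : dual Y => comp_op g T : dual X) \in
    @bounded_linear R F (dual Y) (dual X).
Proof.
apply/asboolP; split=> [a g h|]; first by apply: val_inj; apply/funext.
exists `|T| => g; apply: op_norm_le => x x1 /=.
rewrite (le_trans (op_norm_bound g _))// mulrC ler_wpM2r ?op_norm_ge0//.
exact: op_norm_ge.
Qed.

Definition adjoint (X Y : normedModType K) (T : bounded_op X Y) :
  bounded_op (dual Y) (dual X) := BoundedOp (adjoint_bounded_linear T).

Definition attains_norm (X Y : normedModType K) (T : bounded_op X Y) : Prop :=
  exists x : X, `|x| = 1 /\ `|T x| = `|T|.

Definition compact_op (X Y : normedModType K) : set (bounded_op X Y) :=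
  [set T | compact (closure [set T x | x in [set x : X | `|x| <= 1]])].

Definition essential_norm (X Y : normedModType K) (T : bounded_op X Y) : K :=
  infimum 0 [set `|T - C| | C in @compact_op X Y].

Definition ACPP (X Y : completeNormedModType K) : Prop :=
  forall T : bounded_op X Y,
    ~ attains_norm (adjoint T) -> essential_norm T = `|T|.

End operators.

Section ell1.
Variables (R : realType) (F : scalar_field).
Local Notation K := (scalars R F).

Definition abs_summable : {pred K^nat} := fun x =>
  `[< cvgn (series (fun n => `|x n|)) >].

Record ell1 := Ell1 {
  ell1_seq :> nat -> K;
  ell1P : ell1_seq \in abs_summable }.

HB.instance Definition _ := [isSub for ell1_seq].
HB.instance Definition _ := [Choice of ell1 by <:].

Local Notation nsum x := (series (fun n => `|x n|)).

Lemma normed_series_nd (x : K^nat) :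
  {homo (nsum x) : m n / (m <= n)%N >-> m <= n}.
Proof.
move=> m n mn; rewrite /series/= [leRHS](big_cat_nat (n := m))//=.
by rewrite lerDl sumr_ge0.
Qed.

Lemma normed_series_cvg (x : K^nat) M : (forall n, (nsum x) n <= M) ->
  (nsum x) @ \oo --> supremum 0 (range (nsum x)).
Proof.
move=> xM; apply: (scalar_cvg_supremum (M := M)) => //.
  by move=> n; rewrite /series/= sumr_ge0.
exact: normed_series_nd.
Qed.

Lemma abs_summableP (x : K^nat) :
  reflect (exists M, forall n, (nsum x) n <= M) (x \in abs_summable).
Proof.
apply: (iffP idP) => [/asboolP/cvg_seq_bounded/pinfty_ex_gt0[M _ xM]|[M xM]].
  exists M => n; apply: le_trans (xM n I).
  by rewrite ger0_norm// /series/= sumr_ge0.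
by apply/asboolP; exact: cvgP (normed_series_cvg xM).
Qed.

Lemma abs_summable_submod : submod_closed abs_summable.
Proof.
split.
  apply/abs_summableP; exists 0 => n.
  by rewrite /series/= big1// => i _; rewrite normr0.
move=> a x y /abs_summableP[M xM] /abs_summableP[N yN].
apply/abs_summableP; exists (`|a| * M + N) => n.
apply: (@le_trans _ _ (`|a| * (nsum x) n + (nsum y) n)).
  rewrite /series/= mulr_sumr -big_split/= ler_sum// => i _.
  by rewrite (le_trans (ler_normD _ _))// normrM.
by rewrite lerD// ler_wpM2l.
Qed.

HB.instance Definition _ :=
  GRing.isSubmodClosed.Build K (nat -> K) abs_summable abs_summable_submod.
HB.instance Definition _ := [SubChoice_isSubLmodule of ell1 by <:].

Definition ell1_norm (x : ell1) : K := limn (series (fun n => `|x n|)).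

Lemma ell1_norm_supremums (x : ell1) :
  supremums (range (nsum x)) (ell1_norm x).
Proof.
have /abs_summableP[M xM] := ell1P x.
rewrite /ell1_norm (cvg_lim _ (normed_series_cvg xM))//.
apply: scalar_supremumP.
- by exists ((nsum x) 0%N), 0%N.
- by exists M => _ [n _ <-].
- by move=> _ [n _ <-]; rewrite /series/= sumr_ge0.
Qed.

Lemma ell1_norm_ge (x : ell1) n : (nsum x) n <= ell1_norm x.
Proof. by have [h _] := ell1_norm_supremums x; apply: h; exists n. Qed.

Lemma ell1_norm_le (x : ell1) M :
  (forall n, (nsum x) n <= M) -> ell1_norm x <= M.
Proof.
by have [_ h] := ell1_norm_supremums x => xM; apply: h => _ [n _ <-].
Qed.

Lemma ell1_norm_coord (x : ell1) n : `|x n| <= ell1_norm x.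
Proof.
apply: le_trans (ell1_norm_ge x n.+1).
by rewrite /series/= big_nat_recr//= lerDr sumr_ge0.
Qed.

Lemma ell1_normD x y : ell1_norm (x + y) <= ell1_norm x + ell1_norm y.
Proof.
apply: ell1_norm_le => n.
apply: le_trans (lerD (ell1_norm_ge x n) (ell1_norm_ge y n)).
by rewrite /series/= -big_split/= ler_sum// => i _; exact: ler_normD.
Qed.

Lemma ell1_normZ a x : ell1_norm (a *: x) = `|a| * ell1_norm x.
Proof.
have le b y : ell1_norm (b *: y) <= `|b| * ell1_norm y.
  apply: ell1_norm_le => n.
  apply: le_trans (ler_wpM2l (normr_ge0 b) (ell1_norm_ge y n)).
  by rewrite /series/= mulr_sumr ler_sum// => i _; rewrite normrM.
apply/le_anti; rewrite le/=; have [->|a0] := eqVneq a 0.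
  by rewrite normr0 mul0r (le_trans _ (ell1_norm_coord _ 0%N)).
by rewrite -ler_pdivlMl ?normr_gt0// -normfV -[in leLHS](scalerK a0 x).
Qed.

Lemma ell1_norm0_eq0 x : ell1_norm x = 0 -> x = 0.
Proof.
move=> x0; apply: val_inj; apply/funext => n.
by apply/eqP; rewrite -normr_le0 -x0; exact: ell1_norm_coord.
Qed.

HB.instance Definition _ :=
  Lmodule_isNormed.Build K ell1 ell1_normD ell1_normZ ell1_norm0_eq0.

Lemma ell1_complete (G : set_system ell1) :
  ProperFilter G -> cauchy G -> cvg G.
Proof.
move=> FG /cauchyP cG.
have /choice[l Gl] n : exists l : K, (fun x : ell1 => x n) @ G --> l.
  apply/cvg_ex; apply: scalar_complete; apply/cauchyP => e e0.
  have [x Gx] := cG _ e0; exists (x n).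
  apply: (@filterS _ G _ _ _ _ Gx) => y.
  rewrite -!ball_normE /=; apply: le_lt_trans.
  exact: (ell1_norm_coord (x - y) n).
have Gsum n : forall e : K, 0 < e ->
    G [set y : ell1 | \sum_(0 <= i < n) `|y i - l i| <= e].
  elim: n => [|n IH] e e0.
    by apply: filterS filterT => y _ /=; rewrite big_geq// ltW.
  have e2 : 0 < e / 2 by rewrite divr_gt0.
  have /cvgrPdist_le/(_ _ e2) Gn := Gl n.
  apply: filterS (filterI (IH _ e2) Gn) => y [/= sy yn].
  by rewrite big_nat_recr//= [leRHS]splitr lerD// distrC.
have near_l (e : K) : 0 < e -> exists A : set ell1, G A /\
    forall x, A x -> forall n, (nsum ((x : nat -> K) - l)) n <= e.
  move=> e0; have e2 : 0 < e / 2 / 2 by rewrite !divr_gt0.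
  have [z Gz] := cG _ e2; exists (ball z (e / 2 / 2)); split=> // x zx n.
  have [y [zy yl]] := filter_ex (filterI Gz (Gsum n _ (divr_gt0 e0 (ltr0n K 2)))).
  have xy : `|x - y| <= e / 2.
    rewrite [leRHS]splitr -(subrK z x) -addrA (le_trans (ler_normD _ _))//.
    move: zx zy; rewrite -!ball_normE /= distrC => zx zy.
    by rewrite lerD// ltW.
  rewrite [leRHS]splitr.
  apply: le_trans (lerD (le_trans (ell1_norm_ge (x - y) n) xy) yl).
  rewrite /series/= -big_split/= ler_sum// => i _.
  by rewrite (le_trans _ (ler_normD _ _))// addrA subrK.
have l_summable : l \in abs_summable.
  have [A [GA Al]] := near_l 1 ltr01; have [x Ax] := filter_ex GA.
  apply/abs_summableP; exists (1 + `|x|) => n.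
  apply: le_trans (lerD (Al x Ax n) (ell1_norm_ge x n)).
  rewrite /series/= -big_split/= ler_sum// => i _.
  by rewrite -[X in _ <= X + _]normrN opprB (le_trans _ (ler_normD _ _))// subrK.
apply: (@cvgP _ _ (Ell1 l_summable)); apply/cvgrPdist_le => e e0.
have [A [GA Al]] := near_l e e0; apply: filterS GA => x /Al xl.
by rewrite distrC; apply: ell1_norm_le.
Qed.

HB.instance Definition _ := Uniform_isComplete.Build ell1 ell1_complete.

End ell1.

(* Main.v *)
Require Import Defs.
From mathcomp Require Import all_boot all_order all_algebra.
From mathcomp Require Import all_classical all_reals all_analysis.
From mathcomp Require Import complex.

Set Implicit Arguments.
Unset Strict Implicit.
Unset Printing Implicit Defensive.

Import Order.TTheory GRing.Theory Num.Theory.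
Import numFieldNormedType.Exports.

Local Open Scope classical_set_scope.
Local Open Scope ring_scope.

(** The counterexample is T x = (sum of x) t - x, where t is a vector of [ell1]
    with strictly positive entries and norm 1. It is a rank one, hence compact,
    operator minus the identity, so its essential norm is at most 1
    ([counterexample_essential_norm_le]).

    For a functional y of norm at most 1, T^* y = y(t) sum - y, so that T^* y
    has norm at most 2. The bound 2 is approached by the functionals whose
    signs are 1 except for a -1 at the index n: such a y has y(t) = 1 - 2 t_n
    and y(e_n) = -1, hence (T^* y)(e_n) = 2 (1 - t_n), and t_n tends to 0. So
    T^*, and with it T, has norm at least 2 ([adjoint_norm_ge]), which exceeds
    the essential norm.

    The value 2 is not reached. If T^* y has norm 2, then |y(t)| = 1. As t is
    a convex combination of the e_k with all weights positive, and y(e_k)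
    lies in the unit disk, strict convexity of the disk makes all the y(e_k)
    equal to y(t) ([extremal_functional_const]). But then T^* y vanishes on
    every e_k, because T e_k = t - e_k, and so T^* y = 0: the signs that make
    y large on t are those for which t and -e_k cancel each other. *)

(** * Scalars *)

Section scalar_facts.
Variables (R : realType) (F : scalar_field).
Local Notation K := (scalars R F).

(** Strict convexity of the unit disk, for a splitting of 1 into two parts whose
    moduli add up to at most 1. The real part of w is squeezed to p, which
    leaves no room for an imaginary part. *)
Lemma unit_split_eq (w p : K) :
  `|w| <= p -> `|1 - w| <= 1 - p -> w = p.
Proof.
case: F w p => /= w p wp w1p.
  apply/le_anti; rewrite (le_trans (ler_norm _) wp)/=.
  by have := le_trans (ler_norm _) w1p; rewrite lerD2l lerN2.
have Re_le (z : R[i]) r : `|z| <= r -> complex.Re z <= complex.Re r.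
  move=> /(le_trans (normc_ge_Re z)); rewrite lecE/= => /andP[_].
  exact: le_trans (ler_norm _).
have p0 : 0 <= p := le_trans (normr_ge0 w) wp.
have pr : p = (complex.Re p)%:C%C.
  by move: p0; rewrite lecE/=; case: (p) => a b /= /andP[/eqP -> _].
have Rew : complex.Re w = complex.Re p.
  apply/le_anti; rewrite (Re_le _ _ wp)/=.
  have := Re_le _ _ w1p; rewrite pr; case: (w) => a b /=.
  by rewrite lerD2l lerN2.
move: wp; rewrite pr -Rew; case: w {w1p Rew} => a b /= wp.
have a0 : 0 <= a by have := le_trans (normr_ge0 _) wp; rewrite lecR.
move: wp; rewrite normc_def/= lecR => ab.
have : a ^+ 2 + b ^+ 2 <= a ^+ 2.
  rewrite -(@ler_sqrt _ _ (a ^+ 2)) ?sqr_ge0// (le_trans ab)//.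
  by rewrite sqrtr_sqr ler_norm.
rewrite gerDl => b2; have /eqP : b ^+ 2 = 0.
  by apply/le_anti; rewrite b2 sqr_ge0.
by rewrite sqrf_eq0 => /eqP ->.
Qed.

(** In the complex case the ball lies in the square of half-side M, which is
    compact as a continuous image of a product of two real segments. *)
Lemma scalar_ball_compact (M : K) :
  exists2 D : set K, compact D & [set a | `|a| <= M] `<=` D.
Proof.
case: F M => /= M.
  exists [set` `[(- M), M]]; first exact: segment_compact.
  by move=> a /= aM; rewrite in_itv/= -ler_norml.
pose f (p : R * R) : R[i] := Complex p.1 p.2.
have fc : continuous (f : _ -> scalars R ComplexScalars).
  move=> [a b]; apply/(@cvgrPdist_lt (scalars R ComplexScalars)) => e e0.
  have er : e = (complex.Re e)%:C%C.
    by move: e0; rewrite ltcE/=; case: (e) => c d /= /andP[/eqP -> _].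
  have e0' : 0 < complex.Re e / 2 by rewrite divr_gt0// -ltcR -er.
  have normRI (x y : R) : `|Complex x y| <= (`|x| + `|y|)%:C%C.
    have xy0 : 0 <= `|x| + `|y| by rewrite addr_ge0.
    rewrite normc_def/= lecR -(ger0_norm xy0) -sqrtr_sqr ler_wsqrtr//.
    by rewrite sqrrD !real_normK ?num_real// addrAC lerDl mulrn_wge0// mulr_ge0.
  have near1 : \forall z \near (a, b), `|a - z.1| < complex.Re e / 2.
    have h : z.1 @[z --> (a, b)] --> a by exact: cvg_fst.
    by move/cvgrPdist_lt : h; apply.
  have near2 : \forall z \near (a, b), `|b - z.2| < complex.Re e / 2.
    have h : z.2 @[z --> (a, b)] --> b by exact: cvg_snd.
    by move/cvgrPdist_lt : h; apply.
  near=> z; rewrite er (le_lt_trans (normRI _ _))// ltcR [ltRHS]splitr ltrD//.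
    by near: z; exact: near1.
  by near: z; exact: near2.
pose J : set R := [set` `[(- complex.Re M), complex.Re M]].
exists (f @` (J `*` J)).
  apply: continuous_compact; first exact: continuous_subspaceT.
  by apply: compact_setX; exact: segment_compact.
have inJ (c : R) : `|c|%:C%C <= M -> J c.
  by rewrite lecE/= => /andP[_]; rewrite /J/= in_itv/= ler_norml.
move=> [a b] /= abM; exists (a, b) => //=; split; apply: inJ.
  exact: le_trans (normc_ge_Re (Complex a b)) abM.
apply: le_trans abM; rewrite normc_def/= lecR -[leLHS]sqrtr_sqr.
by rewrite ler_wsqrtr// lerDr sqr_ge0.
Unshelve. all: by end_near. Qed.

Lemma norm_lim_le (u : nat -> K) (l M : K) :
  u @ \oo --> l -> (forall n, `|u n| <= M) -> `|l| <= M.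
Proof.
move=> ul uM; rewrite real_leNgt ?normr_real//; last first.
  by rewrite ger0_real// (le_trans (normr_ge0 _) (uM 0%N)).
apply/negP => Ml; have e0 : 0 < `|l| - M by rewrite subr_gt0.
have /cvgrPdist_lt/(_ _ e0)/filter_ex[n /= un] := ul.
suff : `|l| < `|l| by rewrite ltxx.
rewrite -{1}(subrK (u n) l) (le_lt_trans (ler_normD _ _))//.
by rewrite -(subrK M `|l|) ltr_leD.
Qed.

End scalar_facts.

(** * Bounded operators *)

Section contractions.
Variables (R : realType) (F : scalar_field).
Local Notation K := (scalars R F).
Variables X Y : normedModType K.

Lemma bounded_opZ (f : bounded_op X Y) (a : K) x : f (a *: x) = a *: f x.
Proof. exact: (linearZ_LR f). Qed.

Lemma bounded_opB (f : bounded_op X Y) x y : f (x - y) = f x - f y.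
Proof. exact: (linearB f). Qed.

Lemma contraction_le (f : bounded_op X Y) x : `|f| <= 1 -> `|f x| <= `|x|.
Proof.
move=> f1; apply: le_trans (op_norm_bound f x) _.
by rewrite -[leRHS]mul1r ler_wpM2r.
Qed.

End contractions.

Section adjoint_and_rank_one.
Variables (R : realType) (F : scalar_field).
Local Notation K := (scalars R F).
Variables X Y : normedModType K.

Lemma adjoint_norm_le (f : bounded_op X Y) : `|adjoint f| <= `|f|.
Proof.
apply: op_norm_le => g g1; apply: op_norm_le => x x1.
exact: le_trans (contraction_le (f x) g1) (op_norm_ge f x1).
Qed.

Lemma id_bounded_linear : idfun \in @bounded_linear R F X X.
Proof. by apply/asboolP; split=> //; exists 1 => x; rewrite mul1r. Qed.

Definition id_op : bounded_op X X := BoundedOp id_bounded_linear.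

Lemma rank_one_bounded (g : bounded_op X K^o) (t : Y) :
  (fun x => (g x : K) *: t) \in @bounded_linear R F X Y.
Proof.
apply/asboolP; split=> [a x y|].
  by rewrite linearP/= scalerDl scalerA.
exists (op_norm g * `|t|) => x.
by rewrite normrZ mulrAC ler_wpM2r// (op_norm_bound g).
Qed.

Definition rank_one (g : bounded_op X K^o) (t : Y) : bounded_op X Y :=
  BoundedOp (rank_one_bounded g t).

(** The image of the unit ball lies in the multiples of t by the scalars of
    modulus at most the norm of g, a compact set by [scalar_ball_compact]. *)
Lemma rank_one_compact (g : bounded_op X K^o) (t : Y) :
  compact_op (rank_one g t).
Proof.
have [D cD ballD] := scalar_ball_compact (op_norm g).
have cDt : compact ((fun a : K^o => a *: t) @` D).
  apply: continuous_compact => //.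
  by apply: continuous_subspaceT; exact: scalel_continuous.
apply: (subclosed_compact (@closed_closure _ _) cDt).
have /closure_id -> := compact_closed (@norm_hausdorff _ _) cDt.
apply: closureS => _ [x /= x1 <-]; exists (g x) => //.
by apply: ballD; exact: op_norm_ge.
Qed.

End adjoint_and_rank_one.

(** * The unit vectors and the sum functional of ell1 *)

Section ell1_facts.
Variables (R : realType) (F : scalar_field).
Local Notation K := (scalars R F).
Local Notation nsum x := (series (fun n => `|x n|)).
Implicit Types x : ell1 R F.

Lemma ell1_addE x y n : (x + y) n = x n + y n. Proof. by []. Qed.
Lemma ell1_oppE x n : (- x) n = - x n. Proof. by []. Qed.
Lemma ell1_scaleE (a : K) x n : (a *: x) n = a * x n. Proof. by []. Qed.

Lemma nsum_basis k n : (nsum (fun i => (i == k)%:R : K)) n = (k < n)%:R.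
Proof.
elim: n => [|n IH]; first by rewrite /series/= big_geq.
rewrite /series/= big_nat_recr//=; move: IH; rewrite /series/= => ->.
by rewrite normr_nat -natrD ltnS; congr _%:R; case: ltngtP.
Qed.

Lemma basis_summable k : (fun i => (i == k)%:R : K) \in @abs_summable R F.
Proof.
by apply/abs_summableP; exists 1 => n; rewrite nsum_basis lern1 leq_b1.
Qed.

Definition basis k : ell1 R F := Ell1 (basis_summable k).

Lemma basis_norm_le k : `|basis k| <= 1.
Proof. by apply: ell1_norm_le => n; rewrite nsum_basis lern1 leq_b1. Qed.

(** The additivity of the norm over disjoint supports, in the direction that the
    later estimates use: deleting the k-th entry lowers the norm by its full
    modulus. *)
Lemma ell1_norm_remove x k : `|x - x k *: basis k| <= `|x| - `|x k|.
Proof.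
apply: ell1_norm_le => n.
(* The partial sum is lengthened so that it contains the index k. *)
apply: le_trans (normed_series_nd _ (leq_addr k.+1 n)) _.
rewrite lerBrDr; apply: le_trans (ell1_norm_ge x (n + k.+1)).
have kin : k \in index_iota 0 (n + k.+1).
  by rewrite mem_index_iota/= addnS ltnS leq_addl.
change (\sum_(0 <= i < n + k.+1) `|x i - x k * (i == k)%:R| + `|x k| <=
  \sum_(0 <= i < n + k.+1) `|x i|).
rewrite (bigD1_seq k)//= ?iota_uniq// [leRHS](bigD1_seq k)//= ?iota_uniq//.
rewrite eqxx mulr1 subrr normr0 add0r [leLHS]addrC; apply: lerD => //.
apply: ler_sum => i /negbTE ->.
by rewrite mulr0 subr0.
Qed.

Lemma ell1_norm_tail x n :
  `|x - \sum_(0 <= i < n) x i *: basis i| <= `|x| - (nsum x) n.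
Proof.
suff [//] : `|x - \sum_(0 <= i < n) x i *: basis i| <= `|x| - (nsum x) n /\
  forall k, (n <= k)%N -> (x - \sum_(0 <= i < n) x i *: basis i) k = x k.
elim: n => [|n [IH coord]].
  by rewrite /series/= !big_geq// !subr0; split.
have nsumS : (nsum x) n.+1 = (nsum x) n + `|x n|.
  by rewrite /series/= big_nat_recr.
rewrite nsumS big_nat_recr// !opprD !addrA.
split.
  rewrite -(coord n)//; apply: le_trans (ell1_norm_remove _ _) _.
  by rewrite (coord n)// lerD2r.
move=> k nk; rewrite ell1_addE coord ?(ltnW nk)// ell1_oppE ell1_scaleE/=.
by rewrite gtn_eqF// mulr0 subr0.
Qed.

(** The tails x - sum_(i < n) x_i e_i tend to 0 in norm. The argument avoids
    limits: were f x nonzero, [ell1_norm_tail] would keep all partial sums of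
    the norm of x below a bound strictly smaller than that norm. *)
Lemma bounded_op_eq0 (Y : normedModType K) (f : bounded_op (ell1 R F) Y) :
  (forall k, f (basis k) = 0) -> f = 0.
Proof.
move=> f0; apply: val_inj; apply/funext => x /=.
apply/eqP/contraT => fx0; have fx : 0 < `|f x| by rewrite normr_gt0.
have le_tail n : `|f x| <= op_norm f * (`|x| - (nsum x) n).
  have -> : f x = f (x - \sum_(0 <= i < n) x i *: basis i).
    rewrite bounded_opB (linear_sum f) big1 ?subr0// => i _.
    by have := bounded_opZ f (x i) (basis i); rewrite f0 scaler0.
  apply: le_trans (op_norm_bound _ _) _.
  by rewrite ler_wpM2l ?op_norm_ge0// ell1_norm_tail.
have f_gt0 : 0 < op_norm f.
  rewrite lt_neqAle op_norm_ge0 andbT eq_sym; apply/eqP => f00.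
  by move: (le_tail 0%N); rewrite f00 mul0r lt_geF.
suff : `|x| <= `|x| - `|f x| / op_norm f.
  by rewrite lerBrDr gerDl lt_geF// divr_gt0.
apply: ell1_norm_le => n.
by rewrite lerBrDr -lerBrDl ler_pdivrMr// mulrC.
Qed.

Lemma series_cvg x : cvgn (series (x : nat -> K)).
Proof.
apply: scalar_complete; apply/(@cauchy_seriesP _ (K^o)) => e e0.
have /asboolP/cvg_cauchy/(@cauchy_seriesP _ (K^o))/(_ _ e0) := ell1P x.
apply: filterS => -[m n] /=; apply: le_lt_trans.
rewrite [leRHS]ger0_norm ?sumr_ge0//; exact: ler_norm_sum.
Qed.

Lemma norm_sum_le x : `|limn (series (x : nat -> K))| <= `|x|.
Proof.
apply: (norm_lim_le (@series_cvg x)) => n.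
exact: le_trans (ler_norm_sum _ _ _) (ell1_norm_ge x n).
Qed.

Lemma sum_bounded_linear :
  (fun x => limn (series (x : nat -> K))) \in
    @bounded_linear R F (ell1 R F) (K^o).
Proof.
apply/asboolP; split; last by exists 1 => x; rewrite mul1r; exact: norm_sum_le.
move=> a x y.
have -> : series ((a *: x + y : ell1 R F) : nat -> K) =
    (fun n => a * series (x : nat -> K) n + series (y : nat -> K) n).
  by apply/funext => n; rewrite /series/= mulr_sumr -big_split.
apply: cvg_lim => //.
apply: (@cvgD _ (K^o)); last exact: series_cvg.
by apply: (@cvgZl_tmp _ (K^o)); exact: series_cvg.
Qed.

Definition sum_op : bounded_op (ell1 R F) K^o := BoundedOp sum_bounded_linear.

Lemma sum_op_basis k : sum_op (basis k) = 1.
Proof.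
apply: cvg_lim => //; apply: cvg_near_cst; exists k.+1 => // n /= kn.
transitivity ((nsum (fun i => (i == k)%:R : K)) n).
  by apply: eq_bigr => i _; rewrite normr_nat.
by rewrite nsum_basis kn.
Qed.

(** A normalised geometric sequence. Dividing by the norm spares computing the
    sum of the series, which would call for an Archimedean argument in K. *)
Lemma positive_unit_vector :
  exists t : ell1 R F, (forall k, 0 < t k) /\ `|t| = 1.
Proof.
have half_gt0 : 0 < 2^-1 :> K by rewrite invr_gt0.
have sS : (fun k => 2^-1 ^+ k.+1 : K) \in @abs_summable R F.
  apply/abs_summableP; exists 1 => n.
  suff -> : (nsum (fun k => 2^-1 ^+ k.+1 : K)) n = 1 - 2^-1 ^+ n.
    by rewrite gerBl exprn_ge0// invr_ge0.
  elim: n => [|n IH]; first by rewrite /series/= big_geq// expr0 subrr.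
  rewrite /series/= big_nat_recr//=; move: IH; rewrite /series/= => ->.
  rewrite ger0_norm ?exprn_ge0 ?invr_ge0// -addrA; congr (_ + _).
  by rewrite exprS {1}[2^-1 ^+ n](splitr (2^-1 ^+ n)) opprD mulrC addrNK.
pose s : ell1 R F := Ell1 sS.
have spos (k : nat) : 0 < s k by exact: (exprn_gt0 k.+1 half_gt0).
have s0 : 0 < `|s|.
  by apply: lt_le_trans (ell1_norm_coord s 0); rewrite normr_gt0 gt_eqF.
exists (`|s|^-1 *: s); split=> [k|].
  by apply: mulr_gt0 (spos k); rewrite invr_gt0.
by rewrite normrZ ger0_norm ?invr_ge0 ?ltW// mulVf ?gt_eqF.
Qed.

End ell1_facts.

(** * The operator x |-> (sum of x) t - x *)

Section counterexample.
Variables (R : realType) (F : scalar_field).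
Local Notation K := (scalars R F).
Local Notation nsum x := (series (fun n => `|x n|)).
Local Notation basis := (@basis R F).
Local Notation sum_op := (@sum_op R F).
Implicit Types x : ell1 R F.
Variable t : ell1 R F.
Hypotheses (tpos : forall k, 0 < t k) (t1 : `|t| = 1).

Definition counterexample : bounded_op (ell1 R F) (ell1 R F) :=
  rank_one sum_op t - id_op (ell1 R F).
Local Notation T := counterexample.

Lemma counterexample_basis k : T (basis k) = t - basis k.
Proof.
have -> : T (basis k) = (sum_op (basis k) : K) *: t - basis k by [].
by rewrite sum_op_basis scale1r.
Qed.

(** The functional with sign -1 at the index n and 1 elsewhere witnesses that the
    norm of T^* is close to 2. The norms of the n-th entry and of the rest of x
    add up, so the two signs do not interact. *)
Lemma norm_sum_flip_le n x : `|(sum_op x : K) - 2 * x n| <= `|x|.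
Proof.
have -> : (sum_op x : K) - 2 * x n = sum_op (x - x n *: basis n) - x n.
  rewrite bounded_opB bounded_opZ sum_op_basis /GRing.scale/= mulr1.
  by rewrite mulr_natl mulr2n opprD addrA.
apply: le_trans (ler_normB _ _) _; rewrite -lerBrDr.
exact: le_trans (norm_sum_le _) (ell1_norm_remove _ _).
Qed.

Lemma sum_flip_bounded n :
  (fun x => (sum_op x : K) - 2 * x n) \in @bounded_linear R F (ell1 R F) (K^o).
Proof.
apply/asboolP; split=> [a x y|].
  rewrite linearP ell1_addE ell1_scaleE mulrDr opprD addrACA.
  by rewrite /GRing.scale/= mulrBr mulrCA.
by exists 1 => x; rewrite mul1r; exact: norm_sum_flip_le.
Qed.

Definition sum_flip n : bounded_op (ell1 R F) K^o :=
  BoundedOp (sum_flip_bounded n).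

Lemma sum_op_unit : sum_op t = 1.
Proof.
rewrite -t1 /=; congr (limn (series _)).
by apply/funext => n; rewrite ger0_norm// ltW.
Qed.

(** Evaluating T^* at [sum_flip n] and then at e_n gives 2 (1 - t_n). As t has
    norm 1, 1 - t_n is at least the n-th partial sum of t, so the supremum over
    n is 2 times the norm of t. *)
Lemma adjoint_norm_ge : 2 <= `|adjoint T|.
Proof.
suff : `|t| <= 2^-1 * `|adjoint T| by rewrite t1 ler_pdivlMl// mulr1.
apply: ell1_norm_le => n; rewrite ler_pdivlMl//.
have flip1 : `|sum_flip n| <= 1.
  by apply: op_norm_le => x; apply: le_trans; exact: norm_sum_flip_le.
apply: le_trans (op_norm_ge (adjoint T) flip1).
apply: le_trans (op_norm_ge (adjoint T (sum_flip n)) (basis_norm_le R F n)).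
have -> : (adjoint T (sum_flip n) : bounded_op (ell1 R F) K^o) (basis n) =
    2 * (1 - t n) :> K.
  transitivity (sum_flip n (t - basis n)).
    by rewrite -counterexample_basis.
  have -> : sum_flip n (t - basis n) =
      (sum_op (t - basis n) : K) - 2 * (t n - (n == n)%:R) by [].
  rewrite bounded_opB sum_op_unit sum_op_basis eqxx subrr sub0r.
  by rewrite -mulrN opprB.
have nsum_le : (nsum t) n + t n <= 1.
  rewrite -t1; apply: le_trans (ell1_norm_ge t n.+1).
  by rewrite /series/= big_nat_recr//= (gtr0_norm (tpos n)).
rewrite normrM ger0_norm// ler_pM2l//.
apply: le_trans (real_ler_norm _); first by rewrite lerBrDr.
by rewrite rpredB ?real1// gtr0_real.
Qed.

Lemma counterexample_norm_ge : 2 <= `|T|.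
Proof. exact: le_trans adjoint_norm_ge (adjoint_norm_le T). Qed.

Lemma counterexample_essential_norm_le : essential_norm T <= 1.
Proof.
have [lb _] : infimums
    [set `|T - C| | C in @compact_op R F (ell1 R F) (ell1 R F)]
    (essential_norm T).
  apply: scalar_infimumP; last by move=> _ [C _ <-].
  exists `|T - rank_one sum_op t|, (rank_one sum_op t) => //.
  exact: rank_one_compact.
apply: (@le_trans _ _ `|T - rank_one sum_op t|).
  apply: lb; exists (rank_one sum_op t) => //.
  exact: rank_one_compact.
rewrite /T addrAC subrr add0r normrN.
by apply: op_norm_le => x.
Qed.

(** With th = y(t) of modulus 1, split 1 = y(t_k e_k) / th + y(t - t_k e_k) / th.
    The two parts have moduli at most t_k and 1 - t_k, so [unit_split_eq]
    identifies the first one with t_k. *)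
Lemma extremal_functional_const (y : bounded_op (ell1 R F) K^o) :
  `|y| <= 1 -> 1 <= `|y t| -> forall k, y (basis k) = y t.
Proof.
move=> y1 yt1 k; set th : K := y t.
have th1 : `|th| = 1.
  by apply/le_anti; rewrite yt1 andbT -t1; exact: contraction_le.
have th0 : th != 0 by rewrite -normr_eq0 th1 oner_eq0.
have tk : 0 < t k := tpos k.
have : t k * y (basis k) / th = t k.
  apply: unit_split_eq.
    rewrite normrM normfV th1 invr1 mulr1 normrM gtr0_norm//.
    apply: ler_piMr; first exact: ltW.
    exact: le_trans (contraction_le _ y1) (basis_norm_le R F k).
  rewrite -{1}(divff th0) -mulrBl normrM normfV th1 invr1 mulr1.
  have -> : th - t k * y (basis k) = y (t - t k *: basis k).
    by rewrite bounded_opB bounded_opZ.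
  apply: le_trans (contraction_le _ y1) _.
  by have := ell1_norm_remove t k; rewrite t1 (gtr0_norm tk).
move/(congr1 (fun a => (t k)^-1 * (a * th))).
by rewrite mulfVK// !mulKf// gt_eqF.
Qed.

Lemma counterexample_adjoint_not_attains : ~ attains_norm (adjoint T).
Proof.
move=> [y [y1 yT]].
have {}y1 : `|y| <= 1 by rewrite y1.
pose y' : bounded_op (ell1 R F) K^o := y.
have Ty x : (adjoint T y : bounded_op (ell1 R F) K^o) x =
    (sum_op x : K) * y' t - y' x.
  have -> : (adjoint T y : bounded_op (ell1 R F) K^o) x =
    y' ((sum_op x : K) *: t - x) by [].
  by rewrite bounded_opB bounded_opZ.
have yt1 : 1 <= `|y' t|.
  have := adjoint_norm_ge; rewrite -yT => T2.
  suff : 2 <= `|y' t| + 1 by rewrite -lerBlDr -addrA subrr addr0.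
  apply: le_trans T2 _; apply: op_norm_le => x x1; rewrite Ty.
  apply: le_trans (ler_normB _ _) _; apply: lerD.
    by rewrite normrM ler_piMl// (le_trans (norm_sum_le x)).
  exact: le_trans (contraction_le _ y1) x1.
have Ty0 : adjoint T y = 0.
  apply: bounded_op_eq0 => k; rewrite Ty sum_op_basis mul1r.
  by rewrite extremal_functional_const ?subrr.
by have := adjoint_norm_ge; rewrite -yT Ty0 normr0 lern0.
Qed.

End counterexample.

Theorem proposition2p3 (R : realType) (F : scalar_field) :
  ~ ACPP (ell1 R F) (ell1 R F) /\
  exists T : bounded_op (ell1 R F) (ell1 R F),
    ~ attains_norm (adjoint T) /\ essential_norm T < `|T|.
Proof.
suff [T [nT eT]] : exists T : bounded_op (ell1 R F) (ell1 R F),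
    ~ attains_norm (adjoint T) /\ essential_norm T < `|T|.
  by split=> [acpp|]; [move: eT; rewrite (acpp T nT) ltxx|exists T].
have [t [tpos t1]] := positive_unit_vector R F.
exists (counterexample t); split.
  exact: counterexample_adjoint_not_attains.
apply: le_lt_trans (counterexample_essential_norm_le t) _.
by apply: lt_le_trans (counterexample_norm_ge tpos t1); rewrite ltr1n.
Qed.
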